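(* Let $p\in\mathbb H$, $0<R_1<R_2$, and let $f$ be a left slice hyperholomorphic function on an axially symmetric open set containing the Cassini shell $U(p,R_1,R_2)$, where it admits the spherical Laurent expansion $$f(q)=\sum_{n\in\mathbb Z}Q_p^n(q)\,[a_{2n}+(q-p)a_{2n+1}],\qquad\{a_n\}_{n\in\mathbb Z}\subseteq\mathbb H,$$ converging absolutely and uniformly on compact subsets of $U(p,R_1,R_2)$. Then $h=\bar Df$ admits, for $q\in U(p,R_1,R_2)$, the expansion $$h(q)=\bar Df(q)=4\sum_{n\in\mathbb Z}n(q-p_0)Q_p^{n-1}(q)[a_{2n}+(q-p)a_{2n+1}]+4\sum_{n\in\mathbb Z}(q_0-p_0)\mathcal L_n(q,p)[a_{2n}+(\bar q-p)a_{2n+1}]+4\sum_{n\in\mathbb Z}Q_p^n(q)a_{2n+1}.$$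
   Context: $\mathbb H$ denotes the quaternions $q=q_0+q_1e_1+q_2e_2+q_3e_3$ with the usual relations ($e_i^2=-1$, $e_1e_2=-e_2e_1=e_3$, $e_2e_3=-e_3e_2=e_1$, $e_3e_1=-e_1e_3=e_2$), $\underline q=q_1e_1+q_2e_2+q_3e_3$, $\bar q=q_0-\underline q$, $\mathbb S=\{\underline q:|\underline q|=1\}$, $[q]=\{q_0+I|\underline q|:I\in\mathbb S\}$; a set $U$ is axially symmetric if $[q]\subset U$ for all $q\in U$. Slice hyperholomorphic: for $U$ axially symmetric open and $\mathcal U=\{(u,v)\in\mathbb R^2:u+\mathbb Sv\subset U\}$, $f:U\to\mathbb H$ is left slice hyperholomorphic if $f(u+Iv)=\alpha(u,v)+I\beta(u,v)$ for all $(u,v)\in\mathcal U$, $I\in\mathbb S$, with $C^1$ functions $\alpha,\beta:\mathcal U\to\mathbb H$, $\alpha$ even and $\beta$ odd in $v$, satisfying $\partial_u\alpha=\partial_v\beta$, $\partial_v\alpha=-\partial_u\beta$. $\bar D=\partial_{q_0}-e_1\partial_{q_1}-e_2\partial_{q_2}-e_3\partial_{q_3}$ acting from the left, in $q$. $p_0=\mathrm{Re}(p)$; $Q_p(q)=q^2-2p_0q+|p|^2$, $Q_p^n(q)=(Q_p(q))^n$ for $n\in\mathbb Z$. Absolute and uniform convergence of the spherical Laurent expansion refers to both series $\sum_{n\in\mathbb Z}Q_p^n(q)a_{2n}$ and $\sum_{n\in\mathbb Z}Q_p^n(q)(q-p)a_{2n+1}$. The Cassini shell is $U(p,R_1,R_2)=\{q\in\mathbb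 H:R_1^2<|Q_p(q)|<R_2^2\}$. For $q\in\mathbb H\setminus[p]$, $$\mathcal L_n(q,p)=\begin{cases}\sum_{k=0}^{n-1}\overline{Q_p^{\,n-1-k}(q)}\,Q_p^k(q),&n\ge1,\\0,&n=0,\\-\sum_{k=0}^{|n|-1}\overline{Q_p^{-k-1}(q)}\,Q_p^{k+n}(q),&n\le-1.\end{cases}$$ *)

(* Defs.v *)
From HB Require Import structures.
From mathcomp Require Import all_boot all_order all_algebra.
From mathcomp Require Import ring lra.
From mathcomp Require Import all_classical all_reals all_analysis.

Set Implicit Arguments.
Unset Strict Implicit.
Unset Printing Implicit Defensive.

Import Order.TTheory GRing.Theory Num.Theory.
Import numFieldNormedType.Exports.

Local Open Scope classical_set_scope.
Local Open Scope ring_scope.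

Record quat (R : Type) := Quat { qre : R; qim1 : R; qim2 : R; qim3 : R }.

Section QuaternionStructures.
Variable R : realType.
Implicit Types x y z : quat R.

Definition prod_of_quat x : R * R * R * R := (qre x, qim1 x, qim2 x, qim3 x).
Definition quat_of_prod (t : R * R * R * R) : quat R :=
  let: (a, b, c, d) := t in Quat a b c d.
Lemma prod_of_quatK : cancel prod_of_quat quat_of_prod.
Proof. by case. Qed.

HB.instance Definition _ := Choice.copy (quat R) (can_type prod_of_quatK).

Lemma quat_eq x y : qre x = qre y -> qim1 x = qim1 y -> qim2 x = qim2 y ->
  qim3 x = qim3 y -> x = y.
Proof. by case: x => ????; case: y => ???? /= -> -> -> ->. Qed.

Definition quat_zero : quat R := Quat 0 0 0 0.
Definition quat_opp x := Quat (- qre x) (- qim1 x) (- qim2 x) (- qim3 x).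
Definition quat_add x y :=
  Quat (qre x + qre y) (qim1 x + qim1 y) (qim2 x + qim2 y) (qim3 x + qim3 y).

Fact quat_addA : associative quat_add.
Proof. by move=> x y z; apply: quat_eq => /=; rewrite addrA. Qed.
Fact quat_addC : commutative quat_add.
Proof. by move=> x y; apply: quat_eq => /=; rewrite addrC. Qed.
Fact quat_add0 : left_id quat_zero quat_add.
Proof. by move=> x; apply: quat_eq => /=; rewrite add0r. Qed.
Fact quat_addN : left_inverse quat_zero quat_opp quat_add.
Proof. by move=> x; apply: quat_eq => /=; rewrite addNr. Qed.

HB.instance Definition _ :=
  GRing.isZmodule.Build (quat R) quat_addA quat_addC quat_add0 quat_addN.

Definition quat_one : quat R := Quat 1 0 0 0.
(* Bilinear extension of e1^2 = e2^2 = e3^2 = -1, e1 e2 = - e2 e1 = e3 and its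
   cyclic permutations. *)
Definition quat_mul x y := Quat
  (qre x * qre y - qim1 x * qim1 y - qim2 x * qim2 y - qim3 x * qim3 y)
  (qre x * qim1 y + qim1 x * qre y + qim2 x * qim3 y - qim3 x * qim2 y)
  (qre x * qim2 y - qim1 x * qim3 y + qim2 x * qre y + qim3 x * qim1 y)
  (qre x * qim3 y + qim1 x * qim2 y - qim2 x * qim1 y + qim3 x * qre y).

Fact quat_mulA : associative quat_mul.
Proof. by move=> x y z; apply: quat_eq => /=; ring. Qed.
Fact quat_mul1x : left_id quat_one quat_mul.
Proof. by move=> x; apply: quat_eq => /=; ring. Qed.
Fact quat_mulx1 : right_id quat_one quat_mul.
Proof. by move=> x; apply: quat_eq => /=; ring. Qed.
Fact quat_mulDl : left_distributive quat_mul quat_add.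
Proof. by move=> x y z; apply: quat_eq => /=; ring. Qed.
Fact quat_mulDr : right_distributive quat_mul quat_add.
Proof. by move=> x y z; apply: quat_eq => /=; ring. Qed.
Fact quat_one_neq0 : quat_one != quat_zero.
Proof. by apply/eqP => -[] /eqP; rewrite oner_eq0. Qed.

HB.instance Definition _ := GRing.Zmodule_isNzRing.Build (quat R)
  quat_mulA quat_mul1x quat_mulx1 quat_mulDl quat_mulDr quat_one_neq0.

Definition quat_scale (k : R) x :=
  Quat (k * qre x) (k * qim1 x) (k * qim2 x) (k * qim3 x).

Fact quat_scaleA a b x : quat_scale a (quat_scale b x) = quat_scale (a * b) x.
Proof. by apply: quat_eq => /=; rewrite mulrA. Qed.
Fact quat_scale1 : left_id 1 quat_scale.
Proof. by move=> x; apply: quat_eq => /=; rewrite mul1r. Qed.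
Fact quat_scaleDr : right_distributive quat_scale +%R.
Proof. by move=> k x y; apply: quat_eq => /=; rewrite mulrDr. Qed.
Fact quat_scaleDl x : {morph quat_scale^~ x : a b / a + b}.
Proof. by move=> a b; apply: quat_eq => /=; rewrite mulrDl. Qed.

HB.instance Definition _ := GRing.Zmodule_isLmodule.Build R (quat R)
  quat_scaleA quat_scale1 quat_scaleDr quat_scaleDl.

Fact quat_scaleAl (k : R) x y : k *: (x * y) = (k *: x) * y.
Proof. by apply: quat_eq => /=; ring. Qed.
HB.instance Definition _ :=
  GRing.Lmodule_isLalgebra.Build R (quat R) quat_scaleAl.

Fact quat_scaleAr (k : R) x y : k *: (x * y) = x * (k *: y).
Proof. by apply: quat_eq => /=; ring. Qed.
HB.instance Definition _ :=
  GRing.Lalgebra_isAlgebra.Build R (quat R) quat_scaleAr.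

Definition qconj x := Quat (qre x) (- qim1 x) (- qim2 x) (- qim3 x).
Definition qnormsq x :=
  qre x ^+ 2 + qim1 x ^+ 2 + qim2 x ^+ 2 + qim3 x ^+ 2.

Lemma qnormsq_ge0 x : 0 <= qnormsq x.
Proof. by rewrite /qnormsq !addr_ge0 ?sqr_ge0. Qed.

Lemma qnormsq_eq0 x : (qnormsq x == 0) = (x == 0).
Proof.
apply/idP/eqP => [|->]; last by rewrite /qnormsq /= expr0n /= !addr0.
rewrite /qnormsq !paddr_eq0 ?addr_ge0 ?sqr_ge0// !sqrf_eq0.
by move=> /andP[/andP[/andP[/eqP ? /eqP ?] /eqP ?] /eqP ?]; apply: quat_eq.
Qed.

Definition quat_inv x := (qnormsq x)^-1 *: qconj x.

Fact quat_mulVr : {in [pred x | x != 0], left_inverse 1 quat_inv *%R}.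
Proof.
move=> x; rewrite inE -qnormsq_eq0 => x0.
by apply: quat_eq => /=; rewrite /qnormsq in x0 *; field.
Qed.
Fact quat_mulrV : {in [pred x | x != 0], right_inverse 1 quat_inv *%R}.
Proof.
move=> x; rewrite inE -qnormsq_eq0 => x0.
by apply: quat_eq => /=; rewrite /qnormsq in x0 *; field.
Qed.
Fact quat_unitP x y : y * x = 1 /\ x * y = 1 -> x != 0.
Proof.
case=> yx _; apply/eqP => x0; move: yx; rewrite x0 mulr0 => /esym/eqP.
by rewrite oner_eq0.
Qed.
Fact quat_inv_out : {in [predC [pred x | x != 0]], quat_inv =1 id}.
Proof.
move=> x; rewrite !inE negbK => /eqP ->.
by apply: quat_eq => /=; rewrite ?oppr0 mulr0.
Qed.
HB.instance Definition _ := GRing.NzRing_hasMulInverse.Build (quat R)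
  quat_mulVr quat_mulrV quat_unitP quat_inv_out.

Definition quat_norm x : R := Num.sqrt (qnormsq x).

Fact quat_ler_normD x y : quat_norm (x + y) <= quat_norm x + quat_norm y.
Proof.
set s := qre x * qre y + qim1 x * qim1 y + qim2 x * qim2 y + qim3 x * qim3 y.
have cs : s <= quat_norm x * quat_norm y.
  rewrite /quat_norm -sqrtrM ?qnormsq_ge0//.
  apply: le_trans (ler_norm _) _; rewrite -sqrtr_sqr ler_wsqrtr//.
  rewrite -subr_ge0.
  have -> : qnormsq x * qnormsq y - s ^+ 2 =
      (qre x * qim1 y - qim1 x * qre y) ^+ 2
    + (qre x * qim2 y - qim2 x * qre y) ^+ 2
    + (qre x * qim3 y - qim3 x * qre y) ^+ 2
    + (qim1 x * qim2 y - qim2 x * qim1 y) ^+ 2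
    + (qim1 x * qim3 y - qim3 x * qim1 y) ^+ 2
    + (qim2 x * qim3 y - qim3 x * qim2 y) ^+ 2.
    by rewrite /qnormsq /s; ring.
  by rewrite !addr_ge0 ?sqr_ge0.
have n0 z : 0 <= quat_norm z by exact: sqrtr_ge0.
rewrite -(@ler_pXn2r _ 2) ?nnegrE ?addr_ge0//.
have sq z : quat_norm z ^+ 2 = qnormsq z by rewrite sqr_sqrtr ?qnormsq_ge0.
rewrite sqrrD !sq.
have -> : qnormsq (x + y) = qnormsq x + s *+ 2 + qnormsq y.
  by rewrite /qnormsq /s /=; ring.
by rewrite lerD2r lerD2l ler_wMn2r.
Qed.

Fact quat_normZ (k : R) x : quat_norm (k *: x) = `|k| * quat_norm x.
Proof.
rewrite /quat_norm -sqrtr_sqr -sqrtrM ?sqr_ge0//; congr Num.sqrt.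
by rewrite /qnormsq /=; ring.
Qed.

Fact quat_norm0_eq0 x : quat_norm x = 0 -> x = 0.
Proof.
move/eqP; rewrite sqrtr_eq0 => h; apply/eqP.
by rewrite -qnormsq_eq0 eq_le h qnormsq_ge0.
Qed.

HB.instance Definition _ := Lmodule_isNormed.Build R (quat R)
  quat_ler_normD quat_normZ quat_norm0_eq0.

End QuaternionStructures.

Section SliceHyperholomorphic.
Variable R : realType.
Local Notation H := (quat R).
Implicit Types (p q I : H) (U : set H).

Definition e1 : H := Quat 0 1 0 0.
Definition e2 : H := Quat 0 0 1 0.
Definition e3 : H := Quat 0 0 0 1.

Definition qvec q : H := Quat 0 (qim1 q) (qim2 q) (qim3 q).

Definition sphereS : set H := [set I | qre I = 0 /\ `|I| = 1].

Definition qclass q : set H :=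
  [set (qre q)%:A + `|qvec q| *: I | I in sphereS].

Definition axially_symmetric U := forall q, U q -> qclass q `<=` U.

Definition slice_dom U : set (R * R) :=
  [set z | forall I, sphereS I -> U (z.1%:A + z.2 *: I)].

Definition du (g : R * R -> H) : R * R -> H := 'D_((1, 0) : R * R) g.
Definition dv (g : R * R -> H) : R * R -> H := 'D_((0, 1) : R * R) g.

Definition C1_on (A : set (R * R)) (g : R * R -> H) := forall z, A z ->
  [/\ derivable g z (1, 0), derivable g z (0, 1),
      {for z, continuous (du g)} & {for z, continuous (dv g)}].

Definition slice_hyperholomorphic U (f : H -> H) :=
  exists alpha beta : R * R -> H,
  [/\ C1_on (slice_dom U) alpha /\ C1_on (slice_dom U) beta,
      forall u v, slice_dom U (u, v) -> alpha (u, - v) = alpha (u, v),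
      forall u v, slice_dom U (u, v) -> beta (u, - v) = - beta (u, v),
      forall z, slice_dom U z ->
        du alpha z = dv beta z /\ dv alpha z = - du beta z
    & forall u v I, slice_dom U (u, v) -> sphereS I ->
        f (u%:A + v *: I) = alpha (u, v) + I * beta (u, v)].

Definition has_partials (f : H -> H) q :=
  [/\ derivable f q 1, derivable f q e1, derivable f q e2
    & derivable f q e3].

Definition Dbar (f : H -> H) : H -> H := fun q =>
  'D_1 f q - e1 * 'D_e1 f q - e2 * 'D_e2 f q - e3 * 'D_e3 f q.

Definition Qp p q : H := q ^+ 2 - (2 * qre p) *: q + (`|p| ^+ 2)%:A.

Definition cassini_shell p (R1 R2 : R) : set H :=
  [set q | R1 ^+ 2 < `|Qp p q| < R2 ^+ 2].

(* [Negz m] is the integer - (m + 1), so that |n| = m.+1 in the second case,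
   while the first one is the empty sum for n = 0. *)
Definition Ln (n : int) q p : H :=
  match n with
  | Posz m => \sum_(k < m) qconj (Qp p q ^ (n - 1 - k%:Z)) * Qp p q ^ k%:Z
  | Negz m => - \sum_(k < m.+1)
                  qconj (Qp p q ^ (- k%:Z - 1)) * Qp p q ^ (k%:Z + n)
  end.

(* A series indexed by [int] converges when its parts over n >= 0 and over
   n <= -1 (that is, n = Negz k for k >= 0) both converge. *)
Definition zcvg (V : normedModType R) (u : int -> V) :=
  cvgn (series (fun k => u (Posz k))) /\ cvgn (series (fun k => u (Negz k))).

Definition zsum (V : normedModType R) (u : int -> V) : V :=
  limn (series (fun k => u (Posz k))) + limn (series (fun k => u (Negz k))).

Definition zabs_cvg (V : normedModType R) (u : int -> V) :=
  zcvg (fun n => `|u n|).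

Definition zunif_cvg (K : set H) (F : int -> H -> H) :=
  exists g h : H -> H,
    {uniform K, (fun N q => \sum_(0 <= k < N) F (Posz k) q) @ \oo --> g} /\
    {uniform K, (fun N q => \sum_(0 <= k < N) F (Negz k) q) @ \oo --> h}.

Definition abs_unif_cvg_on_compacts (A : set H) (F : int -> H -> H) :=
  forall K : set H, compact K -> K `<=` A ->
    (forall q, K q -> zabs_cvg (F ^~ q)) /\ zunif_cvg K F.

End SliceHyperholomorphic.

Arguments e1 {R}.
Arguments e2 {R}.
Arguments e3 {R}.

(* Main.v *)
(* Write Q for Q_p(q).  The coefficients decay geometrically: evaluating the
   expansion at points of the shell where |Q_p| is slightly larger (smaller)
   than |Q| bounds |a_2n| and |a_2n+1| by a geometric sequence.  Hence the
   difference quotients of the terms are dominated, uniformly in the increment,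
   by an arithmetic-geometric series, and dominated convergence allows
   termwise differentiation.

   For a single term, the quaternionic identity
   g - e1 g e1 - e2 g e2 - e3 g e3 = 4 Re g gives
   Dbar (g Q) = (Dbar g) Q + 4 Re(g) (q - 2 p_0) + 4 Re(g q).  Applied to
   g = Q^n, this yields
   Dbar Q^n = 4 n (q - p_0) Q^(n-1) + 4 (q_0 - p_0) L_n by induction on n in
   both directions, since L_(n+1) = L_n Q + conj(Q^n).  The term Q^n (q - p) b
   then follows from the telescoping identity
   2 (q_0 - p_0) L_n (q - conj q) = Q^n - conj(Q^n). *)

Require Import Defs.
From HB Require Import structures.
From mathcomp Require Import all_boot all_order all_algebra.
From mathcomp Require Import ring lra.
From mathcomp Require Import all_classical all_reals all_analysis.
Import Order.TTheory GRing.Theory Num.Theory.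
Import numFieldNormedType.Exports.
Local Open Scope classical_set_scope.
Local Open Scope ring_scope.

(** * The quaternion norm and completeness *)

Section QuaternionNorm.
Context {R : realType}.
Local Notation H := (quat R).
Implicit Types x y : H.

Lemma quat_normE x : `|x| = Num.sqrt (qnormsq x). Proof. by []. Qed.

(** Under the square root this is Euler's four-square identity. *)
Lemma quat_normM x y : `|x * y| = `|x| * `|y|.
Proof.
rewrite !quat_normE -sqrtrM ?qnormsq_ge0//; congr Num.sqrt.
by rewrite /qnormsq /=; ring.
Qed.

Lemma quat_norm1 : `|1 : H| = 1.
Proof. by rewrite quat_normE /qnormsq /= expr1n !expr0n /= !addr0 sqrtr1. Qed.

Lemma quat_normX x n : `|x ^+ n| = `|x| ^+ n.
Proof.
by elim: n => [|n IHn]; rewrite ?expr0 ?quat_norm1// !exprS quat_normM IHn.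
Qed.

Lemma quat_unitE x : (x \is a GRing.unit) = (x != 0).
Proof. by []. Qed.

Lemma quat_normV x : `|x^-1| = `|x|^-1.
Proof.
have [->|x0] := eqVneq x 0; first by rewrite invr_out ?quat_unitE ?eqxx// normr0 invr0.
apply: (@mulfI _ `|x|); first by rewrite normr_eq0.
by rewrite -quat_normM divrr ?quat_unitE// quat_norm1 divff ?normr_eq0.
Qed.

Lemma quat_norm_conj x : `|qconj x| = `|x|.
Proof. by rewrite !quat_normE /qnormsq /= !sqrrN. Qed.

Lemma qconjM x y : qconj (x * y) = qconj y * qconj x.
Proof. by apply: quat_eq => /=; ring. Qed.

Lemma quat_component_le x :
  [/\ `|qre x| <= `|x|, `|qim1 x| <= `|x|, `|qim2 x| <= `|x| & `|qim3 x| <= `|x|].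
Proof.
have := (sqr_ge0 (qre x), sqr_ge0 (qim1 x), sqr_ge0 (qim2 x), sqr_ge0 (qim3 x)).
case=> [[[h0 h1] h2] h3].
split; rewrite quat_normE -sqrtr_sqr ler_wsqrtr// /qnormsq; lra.
Qed.

Lemma quat_norm_le x : `|x| <= `|qre x| + `|qim1 x| + `|qim2 x| + `|qim3 x|.
Proof.
rewrite quat_normE -[leRHS]ger0_norm ?addr_ge0// -sqrtr_sqr ler_wsqrtr//.
rewrite /qnormsq -(real_normK (num_real (qre x))) -(real_normK (num_real (qim1 x))).
rewrite -(real_normK (num_real (qim2 x))) -(real_normK (num_real (qim3 x))).
have := (normr_ge0 (qre x), normr_ge0 (qim1 x), normr_ge0 (qim2 x), normr_ge0 (qim3 x)).
case=> [[[h0 h1] h2] h3]; rewrite -subr_ge0.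
move: `|qre x| `|qim1 x| `|qim2 x| `|qim3 x| h0 h1 h2 h3 => a b c d ????.
have -> : (a + b + c + d) ^+ 2 - (a ^+ 2 + b ^+ 2 + c ^+ 2 + d ^+ 2) =
  2 * (a * b + a * c + a * d + b * c + b * d + c * d) by ring.
by rewrite mulr_ge0// !addr_ge0// mulr_ge0.
Qed.

(** Components are 1-Lipschitz, so they map a Cauchy filter to convergent filters on [R].
    Completeness turns absolute convergence of quaternionic series into convergence. *)
Lemma quat_cauchy_cvg (F : set_system H) :
  ProperFilter F -> cauchy F -> cvg F.
Proof.
move=> FF /cauchyP F_cauchy.
have comp (c : H -> R) : (forall x y, `|c x - c y| <= `|x - y|) ->
    cvg (c @ F).
  move=> cL; apply/cauchy_cvgP; apply/cauchyP => e e0.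
  have [x Fx] := F_cauchy _ e0; exists (c x).
  apply: (@filterS _ F _ (ball x e)) Fx => y; rewrite -!ball_normE /=.
  exact: le_lt_trans.
have cL (c : H -> R) : (forall x, `|c x| <= `|x|) ->
    (forall x y, c (x - y) = c x - c y) ->
    forall x y, `|c x - c y| <= `|x - y| by move=> cn cB x y; rewrite -cB.
have F0 : cvg (@qre R @ F).
  by apply/comp/cL => // x; have [] := quat_component_le x.
have F1 : cvg (@qim1 R @ F).
  by apply/comp/cL => // x; have [] := quat_component_le x.
have F2 : cvg (@qim2 R @ F).
  by apply/comp/cL => // x; have [] := quat_component_le x.
have F3 : cvg (@qim3 R @ F).
  by apply/comp/cL => // x; have [] := quat_component_le x.
apply/cvg_ex; exists (Quat (lim (@qre R @ F)) (lim (@qim1 R @ F))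
  (lim (@qim2 R @ F)) (lim (@qim3 R @ F))).
apply/(@cvgrPdist_lt _ _ _ F FF id) => e e0.
have e40 : 0 < e / 4 by rewrite divr_gt0.
near=> x; apply: le_lt_trans (quat_norm_le _) _ => /=.
have -> : e = e / 4 + e / 4 + e / 4 + e / 4 by field.
rewrite !ltrD//; near: x.
- exact: cvgr_dist_lt F0 _ e40.
- exact: cvgr_dist_lt F1 _ e40.
- exact: cvgr_dist_lt F2 _ e40.
- exact: cvgr_dist_lt F3 _ e40.
Unshelve. all: by end_near. Qed.

End QuaternionNorm.

HB.instance Definition _ (R : realType) :=
  Uniform_isComplete.Build (quat R) (@quat_cauchy_cvg R).

(** * Limits and directional derivatives of noncommutative products *)

Section QuaternionCalculus.
Context {R : realType}.
Local Notation H := (quat R).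

Lemma cvg_quatM {T} {F : set_system T} {FF : Filter F} (f g : T -> H) (a b : H) :
  f @ F --> a -> g @ F --> b -> f x * g x @[x --> F] --> a * b.
Proof.
move=> fa gb.
suff : `|f x * g x - a * b| @[x --> F] --> (0 : R) by move=> /norm_cvg0/subr_cvg0.
have fa0 : `|f x - a| @[x --> F] --> (0 : R).
  exact/norm_cvg0P/subr_cvg0.
have gb0 : `|g x - b| @[x --> F] --> (0 : R).
  exact/norm_cvg0P/subr_cvg0.
have z : `|f x - a| * `|g x| + `|a| * `|g x - b| @[x --> F] --> (0 : R).
  have -> : (0 : R) = 0 * `|b| + `|a| * 0 by rewrite mul0r mulr0 addr0.
  apply: cvgD; apply: cvgM => //; [exact: cvg_norm|exact: cvg_cst].
apply: (squeeze_cvgr _ (cvg_cst _) z).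
near=> x; rewrite normr_ge0 /=.
have -> : f x * g x - a * b = (f x - a) * g x + a * (g x - b).
  by rewrite mulrBl mulrBr addrA subrK.
by rewrite -!quat_normM ler_normD.
Unshelve. all: by end_near. Qed.

Lemma cvg_quatV {T} {F : set_system T} {FF : Filter F} (f : T -> H) (a : H) :
  a != 0 -> f @ F --> a -> (f x)^-1 @[x --> F] --> a^-1.
Proof.
move=> a0 fa.
suff : `|(f x)^-1 - a^-1| @[x --> F] --> (0 : R) by move=> /norm_cvg0/subr_cvg0.
have fa0 : `|f x - a| @[x --> F] --> (0 : R).
  exact/norm_cvg0P/subr_cvg0.
have na0 : `|a| != 0 by rewrite normr_eq0.
have z : `|f x|^-1 * `|f x - a| * `|a^-1| @[x --> F] --> (0 : R).
  have -> : (0 : R) = `|a|^-1 * 0 * `|a^-1| by rewrite mulr0 mul0r.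
  apply: cvgM; last exact: cvg_cst.
  by apply: cvgM => //; apply: cvgV => //; exact: cvg_norm.
apply: (squeeze_cvgr _ (cvg_cst _) z).
near=> x; rewrite normr_ge0 /=.
have fx0 : f x != 0.
  by rewrite -normr_gt0; near: x; apply: cvgr_norm_gt fa _ _; rewrite normr_gt0.
have -> : (f x)^-1 - a^-1 = - ((f x)^-1 * (f x - a) * a^-1).
  by rewrite mulrBr mulVr// mulrBl mul1r mulrK// opprB.
by rewrite normrN !quat_normM quat_normV.
Unshelve. all: by end_near. Qed.

Implicit Types (q v : H) (f g : H -> H).

Lemma quat_is_deriveP q v f (d : H) : is_derive q v f d <->
  h^-1 *: (f (h *: v + q) - f q) @[h --> 0^'] --> d.
Proof.
split=> [[/cvg_ex[l fl] <-]|fd]; first by rewrite /derive (cvg_lim _ fl).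
by split; [apply/cvg_ex; exists d|exact: cvg_lim fd].
Qed.

(** A derivative along [v] gives continuity along that line, which is what the product and inverse
    rules use. *)
Lemma is_derive_line_cvg q v f (d : H) : is_derive q v f d ->
  f (h *: v + q) @[h --> 0^'] --> f q.
Proof.
move=> /quat_is_deriveP fd; apply/subr_cvg0.
have : h *: (h^-1 *: (f (h *: v + q) - f q)) @[h --> 0^'] --> (0 : R) *: d.
  by apply: cvgZ => //; exact: cvg_within.
rewrite scale0r; apply: cvg_trans; apply: near_eq_cvg; near=> h.
rewrite scalerA divff ?scale1r//; near: h; exact: nbhs_dnbhs_neq.
Unshelve. all: by end_near. Qed.

Lemma is_derive_quatM q v f g (df dg : H) :
  is_derive q v f df -> is_derive q v g dg ->
  is_derive q v (fun x => f x * g x) (df * g q + f q * dg).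
Proof.
move=> fd gd; have fc := is_derive_line_cvg _ _ _ _ fd.
have gc := is_derive_line_cvg _ _ _ _ gd.
move/quat_is_deriveP : fd => fd; move/quat_is_deriveP : gd => gd.
apply/quat_is_deriveP.
have -> : (fun h : R => h^-1 *: (f (h *: v + q) * g (h *: v + q) - f q * g q)) =
  (fun h : R => h^-1 *: (f (h *: v + q) - f q) * g (h *: v + q)
    + f q * (h^-1 *: (g (h *: v + q) - g q))).
  apply/funext => h; rewrite -scalerAl -scalerAr -scalerDr; congr (_ *: _).
  by rewrite mulrBl mulrBr addrA subrK.
apply: cvgD; apply: cvg_quatM => //; exact: cvg_cst.
Qed.

Lemma is_derive_quatV q v f (df : H) : f q != 0 ->
  is_derive q v f df ->
  is_derive q v (fun x => (f x)^-1) (- ((f q)^-1 * df * (f q)^-1)).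
Proof.
move=> fq0 fd; have fc := is_derive_line_cvg _ _ _ _ fd.
move/quat_is_deriveP : fd => fd; apply/quat_is_deriveP.
have : - ((f (h *: v + q))^-1 * (h^-1 *: (f (h *: v + q) - f q)) * (f q)^-1)
    @[h --> 0^'] --> - ((f q)^-1 * df * (f q)^-1).
  apply: cvgN; apply: cvg_quatM; last exact: cvg_cst.
  by apply: cvg_quatM => //; exact: cvg_quatV.
apply: cvg_trans; apply: near_eq_cvg; near=> h.
have fh0 : f (h *: v + q) != 0.
  by rewrite -normr_gt0; near: h; apply: cvgr_norm_gt fc _ _; rewrite normr_gt0.
rewrite -[_ * (h^-1 *: _)]scalerAr -scalerAl -scalerN mulrBr mulVr// mulrBl mul1r mulrK//.
by rewrite opprB.
Unshelve. all: by end_near. Qed.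

Lemma derivable_quatX q v f n : derivable f q v ->
  derivable (fun x => f x ^+ n) q v.
Proof.
move=> fd; elim: n => [|n IHn].
  by under eq_fun do rewrite expr0; exact: derivable_cst.
have -> : (fun x => f x ^+ n.+1) = (fun x => f x ^+ n * f x).
  by apply/funext => x; rewrite exprSr.
by have [] := is_derive_quatM _ _ _ _ _ _ (derivableP IHn) (derivableP fd).
Qed.

(** A mean value bound without commutativity, by induction from x^(n+1) - y^(n+1) = (x^n - y^n) x +
    y^n (x - y). *)
Lemma quat_subX_le (x y : H) (r : R) n : `|x| <= r -> `|y| <= r ->
  `|x ^+ n - y ^+ n| <= n%:R * r ^+ n.-1 * `|x - y|.
Proof.
move=> xr yr; have r0 : 0 <= r by exact: le_trans xr.
case: n => [|n]; first by rewrite !expr0 subrr normr0 !mul0r.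
elim: n => [|n IHn]; first by rewrite !expr1 mulr1 mul1r.
rewrite [x ^+ _]exprSr [y ^+ _]exprSr.
have -> : x ^+ n.+1 * x - y ^+ n.+1 * y =
    (x ^+ n.+1 - y ^+ n.+1) * x + y ^+ n.+1 * (x - y).
  by rewrite mulrBl mulrBr addrA subrK.
apply: le_trans (ler_normD _ _) _; rewrite !quat_normM quat_normX /=.
have -> : n.+2%:R * r ^+ n.+1 * `|x - y| =
  n.+1%:R * r ^+ n * `|x - y| * r + r ^+ n.+1 * `|x - y|.
  by rewrite -[n.+2]addn1 natrD exprS; ring.
by rewrite lerD ?ler_pM ?lerXn2r// nnegrE.
Qed.

End QuaternionCalculus.

(** * Linear operations on convergent series *)

Section NormedModuleSeries.
Context {R : realType} {V : normedModType R}.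
Implicit Types (f g : nat -> V) (a b : V) (k : R).

Lemma cvg_seriesD f g a b : series f @ \oo --> a -> series g @ \oo --> b ->
  series (fun n => f n + g n) @ \oo --> a + b.
Proof. by move=> fa gb; rewrite (seriesD f g); exact: cvgD. Qed.

Lemma cvg_seriesB f g a b : series f @ \oo --> a -> series g @ \oo --> b ->
  series (fun n => f n - g n) @ \oo --> a - b.
Proof.
move=> fa gb; apply: cvg_seriesD => //.
by rewrite (seriesN g); exact: cvgN.
Qed.

Lemma cvg_seriesZ k f a : series f @ \oo --> a ->
  series (fun n => k *: f n) @ \oo --> k *: a.
Proof. by move=> fa; rewrite (seriesZ f k); exact: cvgZl_tmp. Qed.

End NormedModuleSeries.

(** * Termwise differentiation under a summable majorant *)

Section TermwiseDerivation.
Context {R : realType} {V : completeNormedModType R}.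

Lemma series_dominated_cvg (z : nat -> V) (B : nat -> R) :
  (forall n, `|z n| <= B n) -> cvgn (series B) -> cvgn (series z).
Proof.
move=> zB cB; apply: normed_cvg; apply: (series_le_cvg _ _ zB cB) => [//|n].
by apply: le_trans (zB n).
Qed.

(** The partial sums beyond [N] differ from the [N]-th one by at most the tail of [B]. *)
Lemma norm_lim_series_le (z : nat -> V) (B : nat -> R) N :
  (forall n, `|z n| <= B n) -> cvgn (series B) ->
  `|limn (series z)| <= `|series z N| + (limn (series B) - series B N).
Proof.
move=> zB cB; have cz := series_dominated_cvg _ _ zB cB.
have ndB : nondecreasing_seq (series B).
  by apply/nondecreasing_seqP => n; rewrite seriesSr lerDl (le_trans _ (zB n)).
rewrite -(lim_norm cz); apply: limr_le; first exact: is_cvg_norm.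
exists N => // m /= Nm.
have -> : series z m = series z N + (series z m - series z N) by rewrite addrC subrK.
apply: le_trans (ler_normD _ _) _; rewrite lerD2l.
apply: (@le_trans _ _ (series B m - series B N)); last first.
  by rewrite lerD2r nondecreasing_cvgn_le.
rewrite !sub_series_geq//; apply: le_trans (ler_norm_sum _ _ _) _.
exact: ler_sum.
Qed.

(** Dominated convergence: [M] bounds the difference quotients for all [n] and all small [h] at
    once, and [d n] inherits the bound in the limit. The tail is then small uniformly in [h], and
    the head is a finite sum of vanishing terms. *)
Lemma is_derive_series {W : normedModType R} (u : nat -> W -> V)
    (d : nat -> V) (M : nat -> R) (q v : W) :
  (forall n, is_derive q v (u n) (d n)) ->
  cvgn (series M) ->
  (\forall h \near 0^', forall n, `|h^-1 *: (u n (h *: v + q) - u n q)| <= M n) ->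
  cvgn (series (u ^~ q)) ->
  cvgn (series d) /\
  is_derive q v (fun x => limn (series (u ^~ x))) (limn (series d)).
Proof.
move=> du cM uM cq.
have qd n : h^-1 *: (u n (h *: v + q) - u n q) @[h --> 0^'] --> d n.
  by have [/cvg_ex[l ul] <-] := du n; rewrite /derive (cvg_lim _ ul).
have dM n : `|d n| <= M n.
  apply: (@cvgr_to_le _ _ _ _ _ _ _ (cvg_norm (qd n))).
  by apply: filterS uM => h; apply.
have cd : cvgn (series d) by exact: series_dominated_cvg dM cM.
split=> //.
suff qD : h^-1 *: (limn (series (u ^~ (h *: v + q))) - limn (series (u ^~ q)))
    @[h --> 0^'] --> limn (series d).
  by split; [apply/cvg_ex; exists (limn (series d))|exact: cvg_lim qD].
(* Each error term is a difference of two quantities bounded by [M n]. *)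
have cM2 : cvgn (series (2 *: M)) by exact: is_cvg_seriesZ.
apply/cvgrPdist_lt => e e0.
have [N tailN] : exists N, limn (series (2 *: M)) - series (2 *: M) N < e / 2.
  have /cvgrPdist_lt/(_ (e / 2)) := cM2; rewrite divr_gt0// => /(_ isT)[N _ /(_ N)] /= MN.
  by exists N; apply: le_lt_trans (MN (leqnn _)); exact: ler_norm.
have headN : series (fun n => d n - h^-1 *: (u n (h *: v + q) - u n q)) N
    @[h --> 0^'] --> 0.
  elim: N {tailN} => [|N IHN].
    rewrite (_ : (fun _ => _) = cst 0); first exact: cvg_cst.
    by apply/funext => h; rewrite /series/= big_geq.
  under eq_fun do rewrite seriesSr.
  rewrite -[0]addr0; apply: cvgD => //.
  by rewrite -(subrr (d N)); apply: cvgB; [exact: cvg_cst|exact: qd].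
near=> h.
have uMh n : `|h^-1 *: (u n (h *: v + q) - u n q)| <= M n.
  by move: n; near: h.
have h0 : h != 0 by near: h; exact: nbhs_dnbhs_neq.
have cw := series_dominated_cvg _ _ uMh cM.
(* The series at the displaced point converges because it is the series at [q] plus [h] times the
   summable quotients. *)
have -> : limn (series (u ^~ (h *: v + q))) = limn (series (u ^~ q)) +
    h *: limn (series (fun n => h^-1 *: (u n (h *: v + q) - u n q))).
  rewrite -(cvg_lim _ (cvg_seriesD _ _ _ _ cq (cvg_seriesZ h _ _ cw)))//.
  congr (limn (series _)); apply/funext => n.
  by rewrite scalerA divff// scale1r [RHS]addrC subrK.
rewrite [limn (series (u ^~ q)) + _]addrC addrK scalerA mulVf// scale1r.
rewrite -(cvg_lim _ (cvg_seriesB _ _ _ _ cd cw))//.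
apply: le_lt_trans (norm_lim_series_le _ (2 *: M) N _ cM2) _.
  move=> n; apply: le_trans (ler_normB _ _) _.
  have -> : (2 *: M) n = M n + M n by rewrite -[RHS]mulr2n -[RHS]mulr_natl.
  exact: lerD.
have -> : e = e / 2 + e / 2 by field.
apply: ltrD => //.
near: h; move/cvgr0Pnorm_lt : headN; apply; exact: divr_gt0.
Unshelve. all: by end_near. Qed.

End TermwiseDerivation.

(** * A summable majorant for differentiated power series *)

Section ArithmeticGeometric.
Context {R : realType}.

(* The closed form is (1 - r)^2 S_N = 1 - r^N (N + 1 - N r). *)
Lemma is_cvg_arith_geometric_series (r : R) : 0 <= r -> r < 1 ->
  cvgn (series (fun n => n.+1%:R * r ^+ n)).
Proof.
move=> r0 r1; have r10 : 0 < (1 - r) ^+ 2 by rewrite exprn_gt0// subr_gt0.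
have closed N : (1 - r) ^+ 2 * series (fun n => n.+1%:R * r ^+ n) N =
    1 - r ^+ N * (N.+1%:R - N%:R * r).
  elim: N => [|N IHN]; first by rewrite /series/= big_geq// expr0; ring.
  by rewrite seriesSr mulrDr IHN [r ^+ N.+1]exprS -!natr1; ring.
apply: nondecreasing_is_cvgn.
  by apply/nondecreasing_seqP => n; rewrite seriesSr lerDl mulr_ge0// exprn_ge0.
exists ((1 - r) ^- 2) => _ [N _ <-].
rewrite -[leRHS]mulr1 ler_pdivlMl// closed lerBlDr lerDl mulr_ge0 ?exprn_ge0//.
rewrite subr_ge0 -addn1 natrD; apply: (@le_trans _ _ N%:R); last by rewrite lerDl.
by rewrite -[leRHS]mulr1 ler_wpM2l// ltW.
Qed.

End ArithmeticGeometric.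

(** * Derivatives of one-sided quaternionic power series *)

Section PowerSeries.
Context {R : realType}.
Local Notation H := (quat R).

(** Both halves of the Laurent series have this shape: [X] is Q or Q^-1, and [Y], [Z] can hold the
    extra factor Q^-1 of the negative half. *)
Lemma is_derive_quat_power_series (X Y Z : H -> H) (b c : nat -> H)
    (mu C : R) (q v : H) :
  derivable X q v -> derivable Y q v -> derivable Z q v ->
  `|X q| < mu ->
  (forall n, `|b n| * mu ^+ n <= C) -> (forall n, `|c n| * mu ^+ n <= C) ->
  let u n x := X x ^+ n * (Y x * b n + Z x * c n) in
  [/\ forall n, derivable (u n) q v, cvgn (series (fun n => 'D_v (u n) q)) &
    is_derive q v (fun x => limn (series (u ^~ x)))
      (limn (series (fun n => 'D_v (u n) q)))].
Proof.
move=> /derivableP dX /derivableP dY /derivableP dZ Xmu bC cC u.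
have mu0 : 0 < mu by exact: le_lt_trans Xmu.
have dyc n : is_derive q v (fun x => Y x * b n + Z x * c n)
    ('D_v Y q * b n + 'D_v Z q * c n).
  have -> : 'D_v Y q * b n + 'D_v Z q * c n =
    ('D_v Y q * b n + Y q * 0) + ('D_v Z q * c n + Z q * 0).
    by rewrite !mulr0 !addr0.
  by apply: is_deriveD; exact: is_derive_quatM.
have du n : derivable (u n) q v.
  have dXn : derivable (fun x => X x ^+ n) q v by exact: derivable_quatX.
  by have [] := is_derive_quatM _ _ _ _ _ _ (derivableP dXn) (dyc n).
(* [l] lies halfway between [|X q|] and [mu]: it bounds [X] near [q] along [v], and [l / mu] is
   still below 1. *)
pose l := (`|X q| + mu) / 2.
have l0 : 0 < l by rewrite divr_gt0// ltr_wpDl.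
have Xl : `|X q| < l by rewrite /l; lra.
have lmu : l < mu by rewrite /l; lra.
pose r := l / mu.
have r0 : 0 <= r by rewrite divr_ge0// ltW.
have r1 : r < 1 by rewrite ltr_pdivrMr// mul1r.
(* The added 1 in [B] and [L] makes the bounds strict at the limit, hence valid for small [h]. *)
pose B := `|Y q| + `|Z q| + 1.
pose L := `|'D_v X q| + `|'D_v Y q| + `|'D_v Z q| + 1.
have B0 : 0 <= B by rewrite !addr_ge0.
have L0 : 0 <= L by rewrite !addr_ge0.
have C0 : 0 <= C by apply: le_trans (bC 0); rewrite mulr_ge0// expr0.
have coef a n : `|a| * mu ^+ n <= C -> l ^+ n * `|a : H| <= C * r ^+ n.
  move=> aC; rewrite [r ^+ n]expr_div_n mulrA ler_pdivlMr ?exprn_gt0//.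
  by rewrite -mulrA [leRHS]mulrC ler_wpM2l// exprn_ge0// ltW.
(* In the constant, [2 * C] stems from the two coefficients, [B / l] from the increment of the power
   and 1 from the increments of [Y] and [Z]. *)
have [] := is_derive_series u (fun n => 'D_v (u n) q)
    (fun n => (2 * C * L * (B / l + 1)) *: (n.+1%:R * r ^+ n)) q v.
- by move=> n; exact/derivableP.
- exact/is_cvg_seriesZ/is_cvg_arith_geometric_series.
- have qX := (quat_is_deriveP _ _ _ _).1 dX.
  have qY := (quat_is_deriveP _ _ _ _).1 dY.
  have qZ := (quat_is_deriveP _ _ _ _).1 dZ.
  near=> h => n.
  have Xh : `|X (h *: v + q)| <= l.
    by near: h; apply: cvgr_norm_le Xl; exact: is_derive_line_cvg dX.
  have Yh : `|Y (h *: v + q)| <= B.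
    near: h; apply: cvgr_norm_le (is_derive_line_cvg _ _ _ _ dY) _ _.
    by rewrite /B -addrA ltrDl ltr_wpDl.
  have Zh : `|Z (h *: v + q)| <= B.
    near: h; apply: cvgr_norm_le (is_derive_line_cvg _ _ _ _ dZ) _ _.
    by rewrite /B addrAC addrC ltrDl ltr_wpDl.
  have dXh : `|h^-1 *: (X (h *: v + q) - X q)| <= L.
    near: h; apply: cvgr_norm_le qX _ _.
    by rewrite /L -!addrA ltrDl !ltr_wpDl// addr_ge0.
  have dYh : `|h^-1 *: (Y (h *: v + q) - Y q)| <= L.
    near: h; apply: cvgr_norm_le qY _ _.
    by rewrite /L; have := (normr_ge0 ('D_v X q), normr_ge0 ('D_v Z q)); case; lra.
  have dZh : `|h^-1 *: (Z (h *: v + q) - Z q)| <= L.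
    near: h; apply: cvgr_norm_le qZ _ _.
    by rewrite /L; have := (normr_ge0 ('D_v X q), normr_ge0 ('D_v Y q)); case; lra.
  set x := h *: v + q in Xh Yh Zh dXh dYh dZh *.
  (* The increment of the power meets the factor at the displaced point; the increments of [Y] and
     [Z] meet the power at [q]. *)
  have -> : h^-1 *: (u n x - u n q) =
      (h^-1 *: (X x ^+ n - X q ^+ n)) * (Y x * b n + Z x * c n) +
      X q ^+ n * ((h^-1 *: (Y x - Y q)) * b n + (h^-1 *: (Z x - Z q)) * c n).
    rewrite -!scalerAl -!scalerDr -scalerAr -scalerDr; congr (_ *: _).
    rewrite [(Y x - _) * _]mulrBl [(Z x - _) * _]mulrBl addrACA -opprD mulrBr mulrBl.
    by rewrite addrA subrK.
  have Xn : `|h^-1 *: (X x ^+ n - X q ^+ n)| <= n%:R * l ^+ n.-1 * L.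
    rewrite normrZ.
    apply: le_trans (ler_wpM2l _ (quat_subX_le _ _ l n Xh (ltW Xl))) _ => //.
    rewrite mulrCA ler_wpM2l//; first by rewrite mulr_ge0// exprn_ge0// ltW.
    by rewrite -normrZ.
  (* This removes the truncated predecessor; at n = 0 the left side is 0. *)
  have ln : n%:R * l ^+ n.-1 <= n.+1%:R * (l ^+ n / l).
    case: n {Xn} => [|n]; first by rewrite mul0r mulr_ge0// divr_ge0 ?exprn_ge0 ?ltW.
    rewrite exprSr mulfK ?gt_eqF//=; rewrite ler_wpM2r// ?exprn_ge0 ?ltW//.
    by rewrite ltr_nat.
  have bn := coef _ _ (bC n); have cn := coef _ _ (cC n).
  have l10 : 0 <= l ^+ n by rewrite exprn_ge0// ltW.
  apply: (@le_trans _ _ ((n.+1%:R * (l ^+ n / l) * L) * (B * `|b n| + B * `|c n|) +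
      l ^+ n * (L * `|b n| + L * `|c n|))).
    apply: le_trans (ler_normD _ _) _; rewrite lerD// quat_normM.
      apply: ler_pM => //.
        by apply: le_trans Xn _; rewrite ler_wpM2r.
      by apply: le_trans (ler_normD _ _) _; rewrite !quat_normM lerD// ler_wpM2r.
    apply: ler_pM => //.
      by rewrite quat_normX; apply: lerXn2r; rewrite ?nnegrE// ltW.
    by apply: le_trans (ler_normD _ _) _; rewrite !quat_normM lerD// ler_wpM2r.
  have -> : n.+1%:R * (l ^+ n / l) * L * (B * `|b n| + B * `|c n|) +
      l ^+ n * (L * `|b n| + L * `|c n|) =
      L * (n.+1%:R * (B / l) + 1) * (l ^+ n * `|b n| + l ^+ n * `|c n|) by ring.
  have -> : (2 * C * L * (B / l + 1)) *: (n.+1%:R * r ^+ n) =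
      L * (n.+1%:R * (B / l) + n.+1%:R) * (C * r ^+ n + C * r ^+ n).
    by rewrite /GRing.scale/=; ring.
  have Bl : 0 <= n.+1%:R * (B / l) by rewrite mulr_ge0// divr_ge0// ltW.
  apply: ler_pM; rewrite ?lerD//.
  + by rewrite mulr_ge0// addr_ge0.
  + by rewrite addr_ge0// mulr_ge0.
  + by rewrite ler_wpM2l// lerD2l ler1n.
- apply: (@series_dominated_cvg _ _ _ (geometric (2 * B * C) r)); last first.
    by apply: is_cvg_geometric_series; rewrite ger0_norm.
  move=> n; rewrite /u /= quat_normM quat_normX.
  apply: (@le_trans _ _ (l ^+ n * (B * `|b n| + B * `|c n|))).
    apply: ler_pM => //.
      by apply: lerXn2r; rewrite ?nnegrE// ltW.
    apply: le_trans (ler_normD _ _) _; rewrite !quat_normM lerD// ler_wpM2r//.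
      by rewrite /B -addrA lerDl addr_ge0.
    by rewrite /B addrAC addrC lerDl addr_ge0.
  have -> : l ^+ n * (B * `|b n| + B * `|c n|) =
      B * (l ^+ n * `|b n| + l ^+ n * `|c n|) by ring.
  have -> : 2 * B * C * r ^+ n = B * (C * r ^+ n + C * r ^+ n) by ring.
  by rewrite ler_wpM2l// lerD// coef.
- by move=> cd dd; split.
Unshelve. all: by end_near. Qed.

End PowerSeries.

(** * Powers of Q, the sums L_n and the action of [Dbar] *)

Section SphericalPowers.
Context {R : realType}.
Local Notation H := (quat R).
Variable p : H.
Implicit Types (q v : H) (n : int).

Lemma Qp_comm q : GRing.comm (Qp p q) q.
Proof. by apply: quat_eq => /=; ring. Qed.

(** Use q^2 - conj(q)^2 = 2 q_0 (q - conj q), valid since q + conj q = 2 q_0. *)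
Lemma Qp_subconj q :
  Qp p q - qconj (Qp p q) = (2 * (qre q - qre p)) *: (q - qconj q).
Proof. by apply: quat_eq; rewrite /Qp /qconj /=; ring. Qed.

Lemma exprz_succ (w : H) n : w != 0 -> w ^ (n + 1) = w ^ n * w.
Proof. by move=> w0; rewrite exprzDr. Qed.

Lemma Ln0 q : Ln 0 q p = 0.
Proof. exact: big_ord0. Qed.

(** For n >= 0 the summand k = 0 of L_(n+1) is conj(Q^n) and the others shift; for n < 0 the last
    summand of L_n Q is - conj(Q^n) and cancels. *)
Lemma Ln_succ n q : Qp p q != 0 ->
  Ln (n + 1) q p = Ln n q p * Qp p q + qconj (Qp p q ^ n).
Proof.
move=> Q0; case: n => m.
  have -> : (m%:Z + 1 = m.+1%:Z)%R by rewrite -addn1 PoszD.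
  rewrite /Ln big_ord_recl mulr_suml addrC; congr (_ + _).
    apply: eq_bigr => k _; rewrite /= /bump /= add1n.
    rewrite -[k.+1%:Z]/(1 + k%:Z) [1 + _]addrC exprz_succ// mulrA.
    by have -> : m.+1%:Z - 1 - (k%:Z + 1) = m%:Z - 1 - k%:Z by rewrite intS; ring.
  rewrite expr0z mulr1 /=.
  by have -> : m.+1%:Z - 1 - 0 = m%:Z by rewrite intS; ring.
have -> : Ln (Negz m) q p * Qp p q + qconj (Qp p q ^ Negz m) =
    - \sum_(k < m) qconj (Qp p q ^ (- k%:Z - 1)) * Qp p q ^ (k%:Z + Negz m + 1).
  rewrite /Ln mulNr mulr_suml big_ord_recr /= opprD -addrA.
  have -> : - m%:Z - 1 = Negz m by rewrite NegzE intS; ring.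
  have -> : qconj (Qp p q ^ Negz m) * Qp p q ^ (m%:Z + Negz m) * Qp p q =
      qconj (Qp p q ^ Negz m).
    rewrite -mulrA -exprz_succ//; have -> : m%:Z + Negz m + 1 = 0.
      by rewrite NegzE intS; ring.
    by rewrite expr0z mulr1.
  rewrite addNr addr0; congr (- _); apply: eq_bigr => k _.
  by rewrite -mulrA -exprz_succ.
(* The step from -1 to 0 changes branch; both sides are empty sums. *)
case: m => [|m]; first by rewrite big_ord0 oppr0 -[Negz 0 + 1]/(0 : int) Ln0.
have -> : Negz m.+1 + 1 = Negz m by rewrite !NegzE !intS; ring.
rewrite /Ln; congr (- _); apply: eq_bigr => k _; congr (_ * _ ^ _).
by rewrite !NegzE !intS; ring.
Qed.

Lemma exprz_comm (w x : H) n : GRing.comm w x -> w ^ n * x = x * w ^ n.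
Proof. by move=> wx; apply/esym; apply: commrXz; exact/commr_sym. Qed.

(** Suited to steps that multiply by an invertible factor: one identity between n and n + 1 serves
    both directions. *)
Lemma int_succ_ind (P : int -> Prop) : P 0 ->
  (forall n, P n -> P (n + 1)) -> (forall n, P (n + 1) -> P n) -> forall n, P n.
Proof.
move=> P0 Pup Pdown; elim/int_rect => // n IHn.
  by rewrite -addn1 PoszD; exact: Pup.
by apply: Pdown; rewrite -addn1 PoszD opprD addrNK.
Qed.

(** By [Qp_subconj] the claim is L_n (Q - conj Q) = Q^n - conj(Q^n). The defect of this equation is
    0 at n = 0 and gets multiplied by Q from n to n + 1. *)
Lemma Ln_telescope n q : Qp p q != 0 ->
  (2 * (qre q - qre p)) *: (Ln n q p * (q - qconj q)) =
  Qp p q ^ n - qconj (Qp p q ^ n).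
Proof.
move=> Q0; rewrite scalerAr -Qp_subconj.
have step m : Ln (m + 1) q p * (Qp p q - qconj (Qp p q)) -
      (Qp p q ^ (m + 1) - qconj (Qp p q ^ (m + 1))) =
    (Ln m q p * (Qp p q - qconj (Qp p q)) -
      (Qp p q ^ m - qconj (Qp p q ^ m))) * Qp p q.
  have QcC : Qp p q * qconj (Qp p q) = qconj (Qp p q) * Qp p q.
    by apply: quat_eq => /=; ring.
  have gC : qconj (Qp p q) * qconj (Qp p q ^ m) = qconj (Qp p q ^ m) * qconj (Qp p q).
    by rewrite -!qconjM exprz_comm.
  rewrite Ln_succ// exprz_succ// qconjM gC.
  move: (Ln m q p) (Qp p q ^ m) (qconj (Qp p q ^ m)) => l g g'.
  (* What the recurrences leave over is [l] times a commutator, zero for Q and its conjugate. *)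
  have E (w w' : H) : (l * w + g') * (w - w') - (g * w - g' * w') -
      (l * (w - w') - (g - g')) * w = l * (w' * w - w * w').
    by apply: quat_eq => /=; ring.
  by apply/eqP; rewrite -subr_eq0 E QcC subrr mulr0.
apply/eqP; rewrite -subr_eq0; apply/eqP; move: n; apply: int_succ_ind => [|m IHm|m].
- by rewrite Ln0 expr0z mul0r; apply: quat_eq => /=; ring.
- by rewrite step IHm mul0r.
- rewrite step => /(congr1 ( *%R^~ (Qp p q)^-1)).
  by rewrite mulrK ?mul0r ?quat_unitE.
Qed.

Lemma norm_exprz (w : H) n : `|w ^ n| = `|w| ^ n.
Proof.
case: n => m; first by rewrite -!exprnP quat_normX.
by rewrite NegzE -!exprnN quat_normV quat_normX.
Qed.

(** Each of the |n| summands has norm |Q|^(n-1), as its two exponents add up to n - 1. *)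
Lemma norm_Ln_le n q : Qp p q != 0 ->
  `|Ln n q p| <= `|n|%N%:R * `|Qp p q| ^ (n - 1).
Proof.
move=> Q0; have nQ0 : `|Qp p q| != 0 by rewrite normr_eq0.
have term i j : `|qconj (Qp p q ^ i) * Qp p q ^ j| = `|Qp p q| ^ (i + j).
  by rewrite quat_normM quat_norm_conj !norm_exprz exprzDr ?unitfE.
case: n => m; rewrite /Ln ?normrN; apply: le_trans (ler_norm_sum _ _ _) _.
  under eq_bigr => k _ do rewrite term subrK.
  by rewrite sumr_const card_ord mulr_natl.
have E (k : 'I_m.+1) : - k%:Z - 1 + (k%:Z + Negz m) = Negz m - 1 by ring.
under eq_bigr => k _ do rewrite term E.
by rewrite sumr_const card_ord mulr_natl.
Qed.

(* The sum of [conj(e_i) g (d_i Q)] over i = 0, ..., 3, where e_0 = 1. *)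
Definition dQp_trace q (g : H) : H :=
  (4 * qre g) *: (q - (2 * qre p)%:A) + (4 * qre (g * q))%:A.

Lemma is_derive_Qp q v :
  is_derive q v (Qp p) (v * q + q * v - (2 * qre p) *: v).
Proof.
have -> : Qp p = (fun x : H => x * x) - (2 * qre p) \*: id + cst (`|p| ^+ 2)%:A.
  by apply/funext => x; rewrite /Qp expr2.
have -> : v * q + q * v - (2 * qre p) *: v =
  v * q + q * v - (2 * qre p) *: v + 0 by rewrite addr0.
apply: is_deriveD; apply: is_deriveB.
by apply: is_derive_quatM; exact: is_derive_id.
Qed.

Lemma Dbar_is_derive (f : H -> H) (d : H -> H) q :
  (forall v, is_derive q v f (d v)) ->
  Dbar f q = d 1 - e1 * d e1 - e2 * d e2 - e3 * d e3.
Proof. by move=> fd; rewrite /Dbar !derive_val. Qed.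

(** The units multiply from the left, so differentiating [f] gives [Dbar f] times Q; differentiating
    Q gives the sum of conj(e_i) f (d_i Q), which is the trace. *)
Lemma Dbar_mulQp (f : H -> H) q : (forall v, derivable f q v) ->
  (forall v, derivable (fun x => f x * Qp p x) q v) /\
  Dbar (fun x => f x * Qp p x) q = Dbar f q * Qp p q + dQp_trace q (f q).
Proof.
move=> fd.
have D v := is_derive_quatM _ _ _ _ _ _ (derivableP (fd v)) (is_derive_Qp q v).
split=> [v|]; first by have [] := D v.
rewrite (Dbar_is_derive _ _ _ D) /Dbar.
move: ('D_1 f q) ('D_e1 f q) ('D_e2 f q) ('D_e3 f q) (f q) => d0 d1 d2 d3 g.
rewrite /dQp_trace; move: (Qp p q) => Q.
by apply: quat_eq => /=; ring.
Qed.

(** As d(Q^-1) = - Q^-1 (dQ) Q^-1, the trace is taken at f Q^-1 and one Q^-1 factors out on the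
    right. *)
Lemma Dbar_mulQpV (f : H -> H) q : Qp p q != 0 -> (forall v, derivable f q v) ->
  (forall v, derivable (fun x => f x * (Qp p x)^-1) q v) /\
  Dbar (fun x => f x * (Qp p x)^-1) q =
    (Dbar f q - dQp_trace q (f q * (Qp p q)^-1)) * (Qp p q)^-1.
Proof.
move=> Q0 fd.
have D v := is_derive_quatM _ _ _ _ _ _ (derivableP (fd v))
  (is_derive_quatV _ _ _ _ Q0 (is_derive_Qp q v)).
split=> [v|]; first by have [] := D v.
rewrite (Dbar_is_derive _ _ _ D) /Dbar.
move: ('D_1 f q) ('D_e1 f q) ('D_e2 f q) ('D_e3 f q) (f q) => d0 d1 d2 d3 g.
rewrite !mulrN !mulrA; move: (Qp p q)^-1 => w; move: (g * w) => {}g.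
by rewrite /dQp_trace; apply: quat_eq => /=; ring.
Qed.

(** The closed form for [Dbar] of Q^n, named so that its recurrence in n is pure algebra. *)
Definition Dbar_Qp_pow n q : H :=
  (4 * n%:~R) *: ((q - (qre p)%:A) * Qp p q ^ (n - 1))
  + (4 * (qre q - qre p)) *: Ln n q p.

Lemma dQp_trace_comm q (g : H) : g * q = q * g ->
  dQp_trace q g =
    4 *: ((q - (qre p)%:A) * g) + (4 * (qre q - qre p)) *: qconj g.
Proof.
move=> gq.
(* Commutation allows the symmetric form; the identity then holds for every [g] by comparing
   components. *)
have -> : 4 *: ((q - (qre p)%:A) * g) =
    2 *: ((q - (qre p)%:A) * g + g * (q - (qre p)%:A)).
  have -> : g * (q - (qre p)%:A) = (q - (qre p)%:A) * g.
    by rewrite mulrBl mulrBr gq mulr_algr mulr_algl.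
  by rewrite scalerDr -scalerDl; congr (_ *: _); ring.
by rewrite /dQp_trace; apply: quat_eq => /=; ring.
Qed.

Lemma Dbar_Qp_pow_succ n q : Qp p q != 0 ->
  Dbar_Qp_pow (n + 1) q = Dbar_Qp_pow n q * Qp p q + dQp_trace q (Qp p q ^ n).
Proof.
move=> Q0; rewrite dQp_trace_comm; last exact/exprz_comm/Qp_comm.
rewrite /Dbar_Qp_pow Ln_succ// addrK [(_ *: _ + _) * Qp p q]mulrDl.
rewrite -!scalerAl -mulrA -exprz_succ// subrK.
rewrite intrD; move: (n%:~R : R) (_ * Qp p q ^ n) (Ln n q p * _) (qconj _).
by move=> k x y z; apply: quat_eq => /=; ring.
Qed.

(** Both sides satisfy the recurrence of [Dbar_Qp_pow_succ]; downwards it is solved for the lower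
    index by cancelling Q. *)
Lemma Dbar_Qp_powE n q : Qp p q != 0 ->
  (forall v, derivable (fun x => Qp p x ^ n) q v) /\
  Dbar (fun x => Qp p x ^ n) q = Dbar_Qp_pow n q.
Proof.
move=> Q0; elim/int_rect: n => [|n [IHd IHD]|n [IHd IHD]].
- have D v : is_derive q v (fun x => Qp p x ^ 0) 0.
    by under eq_fun do rewrite expr0z; exact: is_derive_cst.
  split=> [v|]; first by have [] := D v.
  rewrite (Dbar_is_derive _ _ _ D) /Dbar_Qp_pow Ln0 scaler0 mulr0z [4 * 0]mulr0 scale0r.
  by rewrite !mulr0 !subr0 addr0.
- have -> : (fun x => Qp p x ^ n.+1) = (fun x => Qp p x ^ n * Qp p x).
    by apply/funext => x; rewrite -!exprnP exprSr.
  have [nd ->] := Dbar_mulQp _ _ IHd; split=> //.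
  by rewrite IHD -Dbar_Qp_pow_succ// -addn1 PoszD.
- have -> : (fun x => Qp p x ^ (- n.+1%:Z)) =
      (fun x => Qp p x ^ (- n%:Z) * (Qp p x)^-1).
    by apply/funext => x; rewrite -!exprnN -!exprVn exprSr.
  have [nd ->] := Dbar_mulQpV _ _ Q0 IHd; split=> //.
  have nE : - n%:Z = - n.+1%:Z + 1 by rewrite intS; ring.
  rewrite IHD; apply: (@mulIr _ (Qp p q)) => //; rewrite -mulrA mulVr// mulr1.
  have -> : Qp p q ^ (- n%:Z) / Qp p q = Qp p q ^ (- n.+1%:Z).
    by rewrite nE exprz_succ// mulrK.
  by rewrite nE Dbar_Qp_pow_succ// addrK.
Qed.

(** Differentiating the affine factor adds 4 Re(g) b with g = Q^n, and 4 Re(g) = 4 g - 2 (g - conj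
    g). The part 4 g b is the last term; by [Ln_telescope] the other part turns q - p into conj(q) -
    p beside L_n. *)
Lemma Dbar_spherical_term n (a b : H) q : Qp p q != 0 ->
  (forall v, derivable (fun x => Qp p x ^ n * (a + (x - p) * b)) q v) /\
  Dbar (fun x => Qp p x ^ n * (a + (x - p) * b)) q =
    4 * (n%:~R * (q - (qre p)%:A) * Qp p q ^ (n - 1) * (a + (q - p) * b))
  + 4 * ((qre q - qre p) *: Ln n q p * (a + (qconj q - p) * b))
  + 4 * (Qp p q ^ n * b).
Proof.
move=> Q0; have [fd fD] := Dbar_Qp_powE n q Q0.
have dl v : is_derive q v (fun x => a + (x - p) * b) (v * b).
  have dxp : is_derive q v (fun x : H => x - p) v.
    by rewrite -[v in is_derive _ _ _ v]subr0; apply: is_deriveB.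
  rewrite -[v * b]add0r; apply: is_deriveD.
  by rewrite -[v * b]addr0 -[X in _ + X](mulr0 (q - p)); apply: is_derive_quatM.
have D v := is_derive_quatM _ _ _ _ _ _ (derivableP (fd v)) (dl v).
split=> [v|]; first by have [] := D v.
have -> : Dbar (fun x => Qp p x ^ n * (a + (x - p) * b)) q =
    Dbar (fun x => Qp p x ^ n) q * (a + (q - p) * b) + (4 * qre (Qp p q ^ n)) *: b.
  rewrite (Dbar_is_derive _ _ _ D) /Dbar.
  move: ('D_1 _ q) ('D_e1 _ q) ('D_e2 _ q) ('D_e3 _ q) (Qp p q ^ n) (a + _).
  by move=> d0 d1 d2 d3 g y; apply: quat_eq => /=; ring.
have reE (g : H) : (4 * qre g) *: b = 4 *: (g * b) - 2 *: ((g - qconj g) * b).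
  by apply: quat_eq => /=; ring.
have four (x : H) : 4 * x = 4 *: x by rewrite mulr_natl scaler_nat.
have intE (x : H) : n%:~R * x = (n%:~R : R) *: x by rewrite mulrzl scaler_int.
rewrite fD reE -Ln_telescope// /Dbar_Qp_pow !four intE.
rewrite -[_ *: (q - _) * Qp p q ^ _]scalerAl.
move: (n%:~R : R) (_ * Qp p q ^ (n - 1)) (Ln n q p) (Qp p q ^ n) => k u l g.
by apply: quat_eq => /=; ring.
Qed.

End SphericalPowers.

(** * Geometric decay of the Laurent coefficients *)

Section LaurentCoefficients.
Context {R : realType}.
Local Notation H := (quat R).
Implicit Types (p q : H) (a : int -> H).

Lemma series_geometric_coef_cvg (z b c : nat -> H) (x mu C K : R) :
  0 <= x -> x < mu -> 0 <= K ->
  (forall m, `|b m| * mu ^+ m <= C) -> (forall m, `|c m| * mu ^+ m <= C) ->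
  (forall m, `|z m| <= K * (m.+1%:R * (x ^+ m * (`|b m| + `|c m|)))) ->
  cvgn (series z).
Proof.
move=> x0 xmu K0 bC cC zK; have mu0 : 0 < mu by exact: le_lt_trans xmu.
pose r := x / mu.
have coef (a : H) m : `|a| * mu ^+ m <= C -> x ^+ m * `|a| <= C * r ^+ m.
  move=> aC; rewrite [r ^+ m]expr_div_n mulrA ler_pdivlMr ?exprn_gt0//.
  by rewrite -mulrA [leRHS]mulrC ler_wpM2l// exprn_ge0.
apply: (@series_dominated_cvg _ _ _ (fun m => (K * (2 * C)) *: (m.+1%:R * r ^+ m))).
  move=> m; apply: le_trans (zK m) _.
  have -> : (K * (2 * C)) *: (m.+1%:R * r ^+ m) =
      K * (m.+1%:R * (C * r ^+ m + C * r ^+ m)) by rewrite /GRing.scale/=; ring.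
  by rewrite !ler_wpM2l// mulrDr lerD// coef.
apply: is_cvg_seriesZ; apply: is_cvg_arith_geometric_series.
  by rewrite divr_ge0// ltW.
by rewrite ltr_pdivrMr// mul1r.
Qed.

Lemma norm_Qp_attained p (rho : R) : 0 <= rho -> exists q, `|Qp p q| = rho.
Proof.
move=> rho0; pose s := qim1 p ^+ 2 + qim2 p ^+ 2 + qim3 p ^+ 2.
have s0 : 0 <= s by rewrite !addr_ge0// sqr_ge0.
have t2 : Num.sqrt (s + rho) ^+ 2 = s + rho by rewrite sqr_sqrtr// addr_ge0.
(* At p_0 + t e_1 the value of Q is s - t^2, where s is the squared norm of the vector part of p;
   this t makes it - rho. *)
exists (Quat (qre p) (Num.sqrt (s + rho)) 0 0).
have -> : Qp p (Quat (qre p) (Num.sqrt (s + rho)) 0 0) = (- rho)%:A.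
  rewrite /Qp quat_normE sqr_sqrtr ?qnormsq_ge0// /qnormsq.
  have -> : qre p ^+ 2 + qim1 p ^+ 2 + qim2 p ^+ 2 + qim3 p ^+ 2 =
      qre p ^+ 2 - rho + Num.sqrt (s + rho) ^+ 2 by rewrite t2 /s; ring.
  move: (Num.sqrt _) => t.
  by apply: quat_eq => /=; rewrite ?expr2; ring.
by rewrite normrZ quat_norm1 mulr1 normrN ger0_norm.
Qed.

Lemma cvg_series_norm_bounded (u : nat -> H) : cvgn (series (fun n => `|u n|)) ->
  exists C, forall n, `|u n| <= C.
Proof.
move=> /cvg_series_bounded[M [_ uM]]; exists (M + 1) => n.
by have := uM (M + 1); rewrite ltrDl => /(_ ltr01 n I); rewrite /= normr_id.
Qed.

Lemma zabs_cvg_bounded (u : int -> H) : zabs_cvg u ->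
  exists C, forall n, `|u n| <= C.
Proof.
move=> [/cvg_series_norm_bounded[C1 h1] /cvg_series_norm_bounded[C2 h2]].
exists (Num.max C1 C2) => -[] m; rewrite le_max ?h1// h2 orbT//.
Qed.

(** The terms of a convergent series are bounded; this is read off at one point with |Q| = rho. That
    point is not p, where Q vanishes, so |q - p| can be divided out. *)
Lemma laurent_coef_bounded p (R1 R2 rho : R) a : R1 ^+ 2 < rho < R2 ^+ 2 ->
  abs_unif_cvg_on_compacts (cassini_shell p R1 R2)
    (fun n q => Qp p q ^ n * a (2 * n)) ->
  abs_unif_cvg_on_compacts (cassini_shell p R1 R2)
    (fun n q => Qp p q ^ n * (q - p) * a (2 * n + 1)) ->
  exists C, forall n, `|a (2 * n)| * rho ^ n <= C /\ `|a (2 * n + 1)| * rho ^ n <= C.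
Proof.
move=> rhoR even_cvg odd_cvg; have rho0 : 0 < rho.
  by case/andP: rhoR => + _; apply: le_lt_trans; exact: sqr_ge0.
have [q Qrho] := norm_Qp_attained p _ (ltW rho0).
have qS : [set q] `<=` cassini_shell p R1 R2.
  by move=> _ ->; rewrite /cassini_shell/= Qrho.
have qp : 0 < `|q - p|.
  rewrite normr_gt0 subr_eq0; apply/eqP => qp.
  move: Qrho; have -> : Qp p q = 0.
    rewrite qp /Qp quat_normE sqr_sqrtr ?qnormsq_ge0// /qnormsq.
    by apply: quat_eq => /=; rewrite ?expr2; ring.
  by rewrite normr0 => /esym/eqP; rewrite gt_eqF.
have [/(_ q erefl)/zabs_cvg_bounded[C1 C1P] _] := even_cvg _ (@compact_set1 _ q) qS.
have [/(_ q erefl)/zabs_cvg_bounded[C2 C2P] _] := odd_cvg _ (@compact_set1 _ q) qS.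
exists (Num.max C1 (C2 / `|q - p|)) => n; rewrite !le_max.
split; apply/orP; [left|right].
  by have := C1P n; rewrite quat_normM norm_exprz Qrho mulrC.
rewrite ler_pdivlMr//; have := C2P n; rewrite !quat_normM norm_exprz Qrho.
by congr (_ <= _); ring.
Qed.

(** The bound is taken at two levels of |Q|: [mu] between |Q| and R2^2 for n >= 0, and [rho] between
    R1^2 and |Q| for n < 0, with [nu] the inverse of [rho]. *)
Lemma laurent_coef_geometric p (R1 R2 : R) a q : cassini_shell p R1 R2 q ->
  abs_unif_cvg_on_compacts (cassini_shell p R1 R2)
    (fun n q => Qp p q ^ n * a (2 * n)) ->
  abs_unif_cvg_on_compacts (cassini_shell p R1 R2)
    (fun n q => Qp p q ^ n * (q - p) * a (2 * n + 1)) ->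
  exists mu nu C : R, [/\ `|Qp p q| < mu, `|Qp p q|^-1 < nu,
    forall m, `|a (2 * Posz m)| * mu ^+ m <= C /\
      `|a (2 * Posz m + 1)| * mu ^+ m <= C &
    forall m, `|a (2 * Negz m)| * nu ^+ m <= C /\
      `|a (2 * Negz m + 1)| * nu ^+ m <= C].
Proof.
move=> /andP[R1q qR2] even_cvg odd_cvg; set t := `|Qp p q| in R1q qR2 *.
have R10 : 0 <= R1 ^+ 2 by exact: sqr_ge0.
pose mu := (t + R2 ^+ 2) / 2; pose rho := (R1 ^+ 2 + t) / 2.
have rho0 : 0 < rho by rewrite /rho; lra.
have [|C1 C1P] := laurent_coef_bounded _ _ _ mu a _ even_cvg odd_cvg.
  by rewrite /mu; apply/andP; split; lra.
have [|C2 C2P] := laurent_coef_bounded _ _ _ rho a _ even_cvg odd_cvg.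
  by rewrite /rho; apply/andP; split; lra.
exists mu, rho^-1, (Num.max C1 (C2 * rho)); split=> [||m|m].
- by rewrite /mu; lra.
- by rewrite ltf_pV2 ?posrE//; rewrite /rho; lra.
- by have [h1 h2] := C1P m; split; rewrite le_max ?h1 ?h2.
(* [Negz m] is - m - 1, so one power of [rho] is left over and enters the constant. *)
- have rhoE : rho ^ Negz m = rho^-1 ^+ m / rho.
    by rewrite NegzE -exprnN -exprVn exprSr.
  have [h1 h2] := C2P (Negz m).
  rewrite rhoE mulrA ler_pdivrMr// in h1; rewrite rhoE mulrA ler_pdivrMr// in h2.
  by split; rewrite le_max ?h1 ?h2 orbT.
Qed.

(** A common test for the three sums of the final formula; the weight |n| + 1 covers the factor n
    and the size of L_n. *)
Lemma zcvg_laurent_dominated p (R1 R2 K : R) a (u : int -> H) q :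
  0 < R1 -> cassini_shell p R1 R2 q -> 0 <= K ->
  abs_unif_cvg_on_compacts (cassini_shell p R1 R2)
    (fun n q => Qp p q ^ n * a (2 * n)) ->
  abs_unif_cvg_on_compacts (cassini_shell p R1 R2)
    (fun n q => Qp p q ^ n * (q - p) * a (2 * n + 1)) ->
  (forall n, `|u n| <= K * (`|n|%N.+1%:R *
    (`|Qp p q| ^ n * (`|a (2 * n)| + `|a (2 * n + 1)|)))) ->
  zcvg u.
Proof.
move=> R10 qS K0 even_cvg odd_cvg uK.
have [mu [nu [C [Qmu Qnu mu_bound nu_bound]]]] :=
  laurent_coef_geometric _ _ _ _ _ qS even_cvg odd_cvg.
have Q0 : 0 < `|Qp p q|.
  by case/andP: qS => + _; apply: le_lt_trans; exact: sqr_ge0.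
split.
  apply: (@series_geometric_coef_cvg _ (fun m => a (2 * Posz m))
    (fun m => a (2 * Posz m + 1)) `|Qp p q| mu C K) => // m.
  - by have [] := mu_bound m.
  - by have [] := mu_bound m.
(* The constant absorbs the 1 / |Q| left by the exponent - m - 1 and the factor 2 in m + 2 <= 2 (m +
   1). *)
apply: (@series_geometric_coef_cvg _ (fun m => a (2 * Negz m))
  (fun m => a (2 * Negz m + 1)) `|Qp p q|^-1 nu C (2 * K / `|Qp p q|)) => //.
- by rewrite mulr_ge0// ?mulr_ge0// invr_ge0.
- by move=> m; have [] := nu_bound m.
- by move=> m; have [] := nu_bound m.
- move=> m; apply: le_trans (uK _) _.
  have -> : `|Qp p q| ^ Negz m = `|Qp p q|^-1 ^+ m / `|Qp p q|.
    by rewrite NegzE -exprnN -exprVn exprSr.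
  pose s := `|Qp p q|^-1 ^+ m / `|Qp p q| * (`|a (2 * Negz m)| + `|a (2 * Negz m + 1)|).
  have s0 : 0 <= s by rewrite !mulr_ge0 ?addr_ge0 ?exprn_ge0 ?invr_ge0.
  have -> : 2 * K / `|Qp p q| * (m.+1%:R * (`|Qp p q|^-1 ^+ m *
      (`|a (2 * Negz m)| + `|a (2 * Negz m + 1)|))) = K * ((2 * m.+1)%:R * s).
    by rewrite natrM /s; ring.
  rewrite -/s ler_wpM2l// ler_wpM2r// ler_nat /=.
  by rewrite mul2n -addnn addSn ltnS leq_addl.
Qed.

End LaurentCoefficients.

(** * Differentiation of the two halves of the Laurent series *)

Section LaurentDerivative.
Context {R : realType}.
Local Notation H := (quat R).
Implicit Types (p q : H) (a : int -> H).

Lemma cvg_seriesMl (c : H) (f : nat -> H) (l : H) : series f @ \oo --> l ->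
  series (fun n => c * f n) @ \oo --> c * l.
Proof.
move=> fl; have -> : series (fun n => c * f n) = (fun n => c * series f n).
  by apply/funext => n; rewrite /series/= mulr_sumr.
by apply: cvg_quatM => //; exact: cvg_cst.
Qed.

Lemma Dbar_is_deriveD (f g h : H -> H) (dg dh : H -> H) q :
  (forall v, is_derive q v f (dg v + dh v)) ->
  (forall v, is_derive q v g (dg v)) -> (forall v, is_derive q v h (dh v)) ->
  Dbar f q = Dbar g q + Dbar h q.
Proof.
move=> fd gd hd; rewrite (Dbar_is_derive _ _ _ fd) (Dbar_is_derive _ _ _ gd).
by rewrite (Dbar_is_derive _ _ _ hd); apply: quat_eq => /=; ring.
Qed.

(** [Dbar] combines four directional derivatives with constant left factors, so termwise
    differentiation carries over to it. *)
Lemma Dbar_lim_series (u : nat -> H -> H) q :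
  (forall v, cvgn (series (fun m => 'D_v (u m) q)) /\
    is_derive q v (fun x => limn (series (u ^~ x)))
      (limn (series (fun m => 'D_v (u m) q)))) ->
  series (fun m => Dbar (u m) q) @ \oo -->
    Dbar (fun x => limn (series (u ^~ x))) q.
Proof.
move=> ud; have c v := (ud v).1; have d v := (ud v).2.
rewrite (Dbar_is_derive _ _ _ d).
by apply: cvg_seriesB; [apply: cvg_seriesB; [apply: cvg_seriesB|]|];
  try apply: cvg_seriesMl; exact: c.
Qed.

(** By continuity of Q the shell is open, so [f] agrees with its expansion near each point of it. *)
Lemma nbhs_cassini_shell p (R1 R2 : R) q : cassini_shell p R1 R2 q ->
  \forall x \near q, cassini_shell p R1 R2 x.
Proof.
move=> /andP[R1q qR2].
have Qc : Qp p x @[x --> q] --> Qp p q.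
  have id_q : x @[x --> q] --> q by exact: cvg_id.
  have sq : x ^+ 2 @[x --> q] --> q ^+ 2.
    under eq_fun do rewrite expr2; rewrite expr2.
    exact: (cvg_quatM _ _ _ _ id_q id_q).
  exact: cvgD (cvgB sq (cvgZl_tmp id_q)) (cvg_cst _).
near=> x; apply/andP; split; near: x.
  exact: cvgr_norm_gt Qc _ R1q.
exact: cvgr_norm_lt Qc _ qR2.
Unshelve. all: by end_near. Qed.

Lemma is_derive_laurent_halves p (R1 R2 : R) a q v : 0 < R1 ->
  cassini_shell p R1 R2 q ->
  abs_unif_cvg_on_compacts (cassini_shell p R1 R2)
    (fun n q => Qp p q ^ n * a (2 * n)) ->
  abs_unif_cvg_on_compacts (cassini_shell p R1 R2)
    (fun n q => Qp p q ^ n * (q - p) * a (2 * n + 1)) ->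
  let u n x := Qp p x ^ n * (a (2 * n) + (x - p) * a (2 * n + 1)) in
  (cvgn (series (fun m => 'D_v (u (Posz m)) q)) /\
    is_derive q v (fun x => limn (series (fun m => u (Posz m) x)))
      (limn (series (fun m => 'D_v (u (Posz m)) q)))) /\
  (cvgn (series (fun m => 'D_v (u (Negz m)) q)) /\
    is_derive q v (fun x => limn (series (fun m => u (Negz m) x)))
      (limn (series (fun m => 'D_v (u (Negz m)) q)))).
Proof.
move=> R10 qS even_cvg odd_cvg u.
have [mu [nu [C [Qmu Qnu mu_bound nu_bound]]]] :=
  laurent_coef_geometric _ _ _ _ _ qS even_cvg odd_cvg.
have Q0 : Qp p q != 0.
  by rewrite -normr_gt0; case/andP: qS => + _; apply: le_lt_trans; exact: sqr_ge0.
have dQ : derivable (Qp p) q v by have [] := is_derive_Qp p q v.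
have dQV := is_derive_quatV _ _ _ _ Q0 (is_derive_Qp p q v).
have dl : is_derive q v (fun x : H => x - p) v.
  by rewrite -[v in is_derive _ _ _ v]subr0; apply: is_deriveB.
have upos : (fun m => u (Posz m)) =
    fun m x => Qp p x ^+ m * (1 * a (2 * Posz m) + (x - p) * a (2 * Posz m + 1)).
  by apply/funext => m; apply/funext => x; rewrite mul1r.
(* Of the m + 1 factors Q^-1, one moves into the coefficient functions, leaving a power series in
   Q^-1. *)
have uneg : (fun m => u (Negz m)) = fun m x => (Qp p x)^-1 ^+ m *
    ((Qp p x)^-1 * a (2 * Negz m) + ((Qp p x)^-1 * (x - p)) * a (2 * Negz m + 1)).
  apply/funext => m; apply/funext => x; rewrite /u NegzE -exprnN -exprVn exprSr.
  by rewrite -mulrA mulrDr mulrA.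
have half (e : nat -> int) w : (fun m => u (e m)) = w ->
    [/\ forall m, derivable (w m) q v, cvgn (series (fun m => 'D_v (w m) q)) &
      is_derive q v (fun x => limn (series (w ^~ x)))
        (limn (series (fun m => 'D_v (w m) q)))] ->
    cvgn (series (fun m => 'D_v (u (e m)) q)) /\
    is_derive q v (fun x => limn (series (fun m => u (e m) x)))
      (limn (series (fun m => 'D_v (u (e m)) q))).
  by move=> <- [].
split.
  apply: half upos _; apply: (@is_derive_quat_power_series _ _ _ _ _ _ mu C).
  - exact: dQ.
  - exact: derivable_cst.
  - by have [] := dl.
  - exact: Qmu.
  - by move=> m; have [] := mu_bound m.
  - by move=> m; have [] := mu_bound m.
apply: half uneg _; apply: (@is_derive_quat_power_series _ _ _ _ _ _ nu C).
- by have [] := dQV.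
- by have [] := dQV.
- by have [] := is_derive_quatM _ _ _ _ _ _ dQV dl.
- by rewrite quat_normV.
- by move=> m; have [] := nu_bound m.
- by move=> m; have [] := nu_bound m.
Qed.

Lemma spherical_coef_norm_le (x a b : H) :
  `|a + x * b| <= (1 + `|x|) * (`|a| + `|b|).
Proof.
apply: le_trans (ler_normD _ _) _; rewrite quat_normM.
have := (normr_ge0 a, normr_ge0 b, normr_ge0 x).
by move: `|a| `|b| `|x| => s t r [[s0 t0] r0]; nra.
Qed.

End LaurentDerivative.

(** * Summation of the termwise formula over both halves *)

Theorem theorem10p10 (R : realType) (p : quat R) (R1 R2 : R)
    (U : set (quat R)) (f : quat R -> quat R) (a : int -> quat R) :
  0 < R1 -> R1 < R2 ->
  open U -> axially_symmetric U ->
  cassini_shell p R1 R2 `<=` U ->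
  slice_hyperholomorphic U f ->
  abs_unif_cvg_on_compacts (cassini_shell p R1 R2)
    (fun n q => Qp p q ^ n * a (2 * n)) ->
  abs_unif_cvg_on_compacts (cassini_shell p R1 R2)
    (fun n q => Qp p q ^ n * (q - p) * a (2 * n + 1)) ->
  (forall q, cassini_shell p R1 R2 q ->
    f q = zsum (fun n => Qp p q ^ n * (a (2 * n) + (q - p) * a (2 * n + 1)))) ->
  forall q, cassini_shell p R1 R2 q ->
    has_partials f q /\
    let S1 := fun n : int => n%:~R * (q - (qre p)%:A) * Qp p q ^ (n - 1)
                * (a (2 * n) + (q - p) * a (2 * n + 1)) in
    let S2 := fun n : int => (qre q - qre p) *: Ln n q p
                * (a (2 * n) + (qconj q - p) * a (2 * n + 1)) in
    let S3 := fun n : int => Qp p q ^ n * a (2 * n + 1) in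
    [/\ zcvg S1, zcvg S2, zcvg S3 &
        Dbar f q = 4 * zsum S1 + 4 * zsum S2 + 4 * zsum S3].
Proof.
move=> R10 _ _ _ _ _ even_cvg odd_cvg fE q qS.
have Q0 : Qp p q != 0.
  by rewrite -normr_gt0; case/andP: qS => + _; apply: le_lt_trans; exact: sqr_ge0.
pose u n x := Qp p x ^ n * (a (2 * n) + (x - p) * a (2 * n + 1)).
pose fpos x := limn (series (fun m => u (Posz m) x)).
pose fneg x := limn (series (fun m => u (Negz m) x)).
have halves v := is_derive_laurent_halves p R1 R2 a q v R10 qS even_cvg odd_cvg.
have dpos v := (halves v).1; have dneg v := (halves v).2.
have df v : is_derive q v f (limn (series (fun m => 'D_v (u (Posz m)) q)) +
    limn (series (fun m => 'D_v (u (Negz m)) q))).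
  apply: (@near_eq_is_derive _ _ _ (fpos + fneg)).
    by near=> x; rewrite fE//; near: x; exact: nbhs_cassini_shell.
  by apply: is_deriveD; [have [] := dpos v|have [] := dneg v].
split.
  by split; [have [] := df 1|have [] := df e1|have [] := df e2|have [] := df e3].
move=> S1 S2 S3.
have nQ0 : 0 < `|Qp p q| by rewrite normr_gt0.
(* [K] collects the factors that depend on [q] but not on [n]. *)
have bound (S : int -> quat R) K : 0 <= K ->
    (forall n, `|S n| <= K * (`|n|%N.+1%:R * (`|Qp p q| ^ n *
      (`|a (2 * n)| + `|a (2 * n + 1)|)))) -> zcvg S.
  by move=> K0; exact: zcvg_laurent_dominated qS _ even_cvg odd_cvg.
have powB n : `|Qp p q| ^ (n - 1) = `|Qp p q| ^ n / `|Qp p q|.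
  by rewrite exprzDr ?unitfE ?gt_eqF// exprN1.
have cS1 : zcvg S1.
  apply: (bound _ (`|q - (qre p)%:A| / `|Qp p q| * (1 + `|q - p|))) => [|n].
    by rewrite mulr_ge0// ?divr_ge0// addr_ge0.
  rewrite /S1 !quat_normM norm_exprz powB.
  have -> : `|n%:~R : quat R| = `|n|%N%:R.
    by rewrite -scaler_int normrZ quat_norm1 mulr1 -intr_norm natr_absz.
  have -> : `|q - (qre p)%:A| / `|Qp p q| * (1 + `|q - p|) * (`|n|%N.+1%:R *
      (`|Qp p q| ^ n * (`|a (2 * n)| + `|a (2 * n + 1)|))) =
    `|n|%N.+1%:R * `|q - (qre p)%:A| * (`|Qp p q| ^ n / `|Qp p q|) *
      ((1 + `|q - p|) * (`|a (2 * n)| + `|a (2 * n + 1)|)) by ring.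
  apply: ler_pM; rewrite ?spherical_coef_norm_le//.
    by rewrite !mulr_ge0 ?invr_ge0 ?exprz_ge0.
  by rewrite !ler_wpM2r ?ler_nat// divr_ge0 ?exprz_ge0.
have cS2 : zcvg S2.
  apply: (bound _ (`|qre q - qre p| / `|Qp p q| * (1 + `|qconj q - p|))) => [|n].
    by rewrite mulr_ge0// ?divr_ge0// addr_ge0.
  rewrite /S2 quat_normM normrZ.
  have -> : `|qre q - qre p| / `|Qp p q| * (1 + `|qconj q - p|) * (`|n|%N.+1%:R *
      (`|Qp p q| ^ n * (`|a (2 * n)| + `|a (2 * n + 1)|))) =
    `|qre q - qre p| * (`|n|%N.+1%:R * (`|Qp p q| ^ n / `|Qp p q|)) *
      ((1 + `|qconj q - p|) * (`|a (2 * n)| + `|a (2 * n + 1)|)) by ring.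
  apply: ler_pM; rewrite ?spherical_coef_norm_le// ?mulr_ge0//.
  rewrite ler_wpM2l//; apply: le_trans (norm_Ln_le _ _ _ Q0) _.
  by rewrite powB ler_wpM2r ?ler_nat// divr_ge0 ?exprz_ge0.
have cS3 : zcvg S3.
  apply: (bound _ 1) => // n; rewrite /S3 quat_normM norm_exprz mul1r.
  rewrite mulrCA ler_wpM2l ?exprz_ge0// -[leLHS]mul1r ler_pM ?ler1n//.
  by rewrite lerDr.
split=> //.
have -> : Dbar f q = Dbar fpos q + Dbar fneg q.
  exact: Dbar_is_deriveD df (fun v => (dpos v).2) (fun v => (dneg v).2).
have term n := (Dbar_spherical_term p n (a (2 * n)) (a (2 * n + 1)) q Q0).2.
have [p1 n1] := cS1; have [p2 n2] := cS2; have [p3 n3] := cS3.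
(* The termwise formula is summed along an enumeration [e], to be taken as [Posz] and [Negz], the
   two halves of [zsum]. *)
have half (e : nat -> int) : cvgn (series (S1 \o e)) -> cvgn (series (S2 \o e)) ->
    cvgn (series (S3 \o e)) ->
    (forall v, cvgn (series (fun m => 'D_v (u (e m)) q)) /\
    is_derive q v (fun x => limn (series (fun m => u (e m) x)))
      (limn (series (fun m => 'D_v (u (e m)) q)))) ->
    Dbar (fun x => limn (series (fun m => u (e m) x))) q =
    4 * limn (series (S1 \o e)) + 4 * limn (series (S2 \o e)) +
    4 * limn (series (S3 \o e)).
  move=> c1 c2 c3 ue; rewrite -(cvg_lim _ (Dbar_lim_series (u \o e) q ue))//.
  apply: cvg_lim => //; under eq_fun do rewrite /= term.
  by apply: cvg_seriesD; [apply: cvg_seriesD|]; exact: cvg_seriesMl.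
rewrite (half Posz p1 p2 p3 dpos) (half Negz n1 n2 n3 dneg) /zsum !mulrDr.
by rewrite addrACA; congr (_ + _); exact: addrACA.
Unshelve. all: by end_near. Qed.
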